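(* Let $\mathcal{D}$ be the set of partitions into distinct parts and $\mathcal{U}$ the set of all partitions. As formal power series in $q$, $$\sum_{\pi\in\mathcal{D}} \widetilde{\omega}_1(\pi)\, q^{|\pi|} = \sum_{\pi\in\mathcal{U}} \omega_1'(\pi)\, q^{|\pi|},$$ where, for $\pi=(\lambda_1,\lambda_2,\dots,\lambda_{\nu(\pi)})$ and with the convention $\lambda_{\nu(\pi)+1}:=-1/2$, $$\widetilde{\omega}_1(\pi)=\prod_{i=1}^{\nu(\pi)}(2\lambda_i-2\lambda_{i+1}-1),$$ and $\omega_1'(\pi)=2^{\nu_d(\pi)}$, with $\nu_d(\pi)$ the number of different parts of $\pi$.
   Context: A partition $\pi=(\lambda_1,\lambda_2,\dots,\lambda_{\nu(\pi)})$ is a finite non-increasing sequence of positive integers (its parts); $\nu(\pi)$ is the number of parts and $|\pi|$ is the sum of the parts. The empty sequence is the unique partition of $0$, and it belongs to both $\mathcal{D}$ and $\mathcal{U}$. $\nu_d(\pi)$ counts the distinct values among the parts of $\pi$ (without multiplicity). Empty products equal $1$. *)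

(* Defs.v *)
From mathcomp Require Import all_boot all_order all_algebra.
From mathcomp Require Import boolp classical_sets functions cardinality fsbigop.

Set Implicit Arguments.
Unset Strict Implicit.
Unset Printing Implicit Defensive.

Import GRing.Theory.
Local Open Scope classical_set_scope.
Local Open Scope ring_scope.

Definition is_partition (p : seq nat) : bool := sorted geq p && (0%N \notin p).

Definition all_partitions : set (seq nat) := [set p | is_partition p].

Definition distinct_partitions : set (seq nat) :=
  [set p | is_partition p && uniq p].

(* [part p i] is lambda_i, indexed from 1; every index beyond [size p], in
   particular [(size p).+1], yields the conventional value -1/2. *)
Definition part (p : seq nat) (i : nat) : rat :=
  nth (- (1 / 2)) [seq k%:R | k <- p] i.-1.

Definition omega1_tilde (p : seq nat) : rat :=
  \prod_(1 <= i < (size p).+1) (2 * part p i - 2 * part p i.+1 - 1).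

Definition num_distinct_parts (p : seq nat) : nat := size (undup p).

Definition omega1_prime (p : seq nat) : rat := 2 ^+ num_distinct_parts p.

(* A formal power series in q is identified with its sequence of
   coefficients. *)
Definition fps := nat -> rat.

(* c * q ^ k *)
Definition fps_monomial (c : rat) (k : nat) : fps :=
  fun n => if n == k then c else 0.

(* The sum of a family of formal power series is taken coefficientwise. It is
   meaningful when, for every n, only finitely many members of the family have a
   nonzero coefficient at q ^ n (the finitely supported sum is 0 otherwise);
   [finite_partitions_of] and [partition_family_finite] below show that this is
   so for families of the form c_p q ^ |p|, p ranging over partitions. *)
Definition fps_sum (T : choiceType) (A : set T) (F : T -> fps) : fps :=
  fun n => \sum_(x \in A) F x n.

Lemma finite_partitions_of (n : nat) :
  finite_set [set p | is_partition p /\ sumn p = n].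
Proof.
have szle p : 0%N \notin p -> (size p <= sumn p)%N.
  elim: p => //= x p IH; rewrite inE negb_or eq_sym -lt0n => /andP[x0 /IH h].
  by rewrite -add1n leq_add.
have lesum p k : k \in p -> (k <= sumn p)%N.
  elim: p => //= x p IH; rewrite inE => /orP[/eqP->|/IH h].
    exact: leq_addr.
  exact: leq_trans h (leq_addl _ _).
pose f (t : n.-bseq 'I_n.+1) : seq nat := map val t.
apply: (sub_finite_set (B := f @` setT)); last first.
  exact/finite_image/finite_finset.
move=> p /= [/andP[_ p0] pn].
have sz : (size (map (@inord n) p) <= n)%N by rewrite size_map -[leqRHS]pn szle.
exists (Bseq sz) => //; rewrite /f /= -map_comp -[RHS]map_id.
by apply/eq_in_map => k /lesum; rewrite pn => kn /=; rewrite inordK.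
Qed.

Lemma partition_family_finite (A : set (seq nat)) (c : seq nat -> rat)
    (n : nat) : A `<=` all_partitions ->
  finite_set [set p | A p /\ fps_monomial (c p) (sumn p) n != 0].
Proof.
move=> sA; apply: (sub_finite_set _ (finite_partitions_of n)) => p /= [/sA Ap].
by rewrite /fps_monomial; case: (n =P _) => [->|_]; rewrite ?eqxx.
Qed.

(* Main.v *)
(* Conjugating a partition into m distinct parts, i.e. recording the differences
   d_i = lambda_i - lambda_(i+1), turns its weight into a product over i and
   evaluates the left-hand side as
     sum_m q^(m(m+1)/2) (-1;q)_m / (q;q)_m^2,
   while recording multiplicities evaluates the right-hand side as the product
   (-q;q)_oo / (q;q)_oo. The two agree by a limiting case of the
   q-Chu-Vandermonde sum
     sum_m [N choose m] q^(m(m+1)/2) (-1;q)_m / (q;q)_m = (-q;q)_N / (q;q)_N,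
   proved by creative telescoping in N. To compare coefficients of q^n it is
   enough to work with x = q in Q[q]/(q^(n+1)), where 1 - x^i is a unit for
   i > 0 and where N = n already gives the infinite sum exactly. *)
Require Import Defs.
From mathcomp Require Import all_boot all_order all_algebra.
From mathcomp Require Import boolp classical_sets functions cardinality fsbigop.
From mathcomp Require Import qpoly zify ring.

Set Implicit Arguments.
Unset Strict Implicit.
Unset Printing Implicit Defensive.

Import GRing.Theory.
Local Open Scope ring_scope.

(** * Nilpotent elements and units *)

Lemma mulr_prod_id (R : comPzSemiRingType) (I : Type) (r : seq I)
    (c : R) (f : I -> R) :
  (forall i, c * f i = c) -> c * \prod_(i <- r) f i = c.
Proof.
by move=> cf; elim/big_rec: _ => [|i y _ IH]; rewrite ?mulr1 // mulrA cf.
Qed.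

Lemma expr_nilp_ge (R : pzSemiRingType) (x : R) n m :
  x ^+ n = 0 -> (n <= m)%N -> x ^+ m = 0.
Proof. by move=> x0 /subnK <-; rewrite exprD x0 mulr0. Qed.

Lemma unit_sub_nilp (R : comUnitRingType) (x : R) n i :
  x ^+ n.+1 = 0 -> 1 - x ^+ i.+1 \is a GRing.unit.
Proof.
move=> x0; have y0 : (x ^+ i.+1) ^+ n.+1 = 0.
  by rewrite -exprM (expr_nilp_ge x0) // leq_pmull.
apply/unitrPr; exists (\sum_(j < n.+1) (x ^+ i.+1) ^+ j).
by rewrite -opprB mulNr -subrX1 y0 sub0r opprK.
Qed.

(** * The finite q-Chu-Vandermonde sum *)

Section QSeries.
Variables (R : comUnitRingType) (x : R).

(* prod_(i < m) qcoef i = x^(m(m+1)/2) (-1;x)_m / (x;x)_m^2. *)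
Definition qcoef (i : nat) : R :=
  x ^+ i.+1 * (1 + x ^+ i) / (1 - x ^+ i.+1) ^+ 2.

(* The summand of the finite q-Chu-Vandermonde sum; it vanishes for m > N. *)
Definition qterm (N m : nat) : R :=
  (\prod_(i < m) qcoef i) * \prod_(i < m) (1 - x ^+ (N - i)).

Lemma qtermS N m : qterm N m.+1 = qterm N m * (qcoef m * (1 - x ^+ (N - m))).
Proof. by rewrite /qterm !big_ord_recr /=; ring. Qed.

(** The factor at i = 0 is 1 - x^(N+1); shifting i turns the others into those for N. *)
Lemma qtermSS N m :
  qterm N.+1 m.+1 = qterm N m * (qcoef m * (1 - x ^+ N.+1)).
Proof. by rewrite /qterm big_ord_recr big_ord_recl /= subn0; ring. Qed.

Hypothesis unit1 : forall i, 1 - x ^+ i.+1 \is a GRing.unit.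

(** The right-hand side is the telescoping certificate: the summand at m > 0 is its increment from M
    = m - 1 to M = m. *)
Lemma qterm_telescope N M : (M <= N)%N ->
  \sum_(m < M.+1) ((1 - x ^+ N.+1) * qterm N.+1 m
                   - (1 + x ^+ N.+1) * qterm N m) =
  - (qterm N M * (1 + x ^+ M) * x ^+ N.+1).
Proof.
elim: M => [_|M IH MN].
  by rewrite big_ord1 /qterm !big_ord0; ring.
rewrite big_ord_recr /= IH ?(ltnW MN) // qtermSS qtermS.
have -> : x ^+ N.+1 = x ^+ (N - M) * x ^+ M.+1.
  by rewrite -exprD; congr (_ ^+ _); lia.
have : qcoef M * (1 - x ^+ M.+1) ^+ 2 = x ^+ M.+1 * (1 + x ^+ M).
  by rewrite divrK // unitrX.
move: (qcoef M) (x ^+ (N - M)) (x ^+ M) (x ^+ M.+1) => q w y z qz.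
apply/eqP; rewrite -subr_eq0; apply/eqP.
(* With x^(N+1) split as wz, the discrepancy is a multiple of the relation [qz] that defines
   [qcoef M]. *)
transitivity (qterm N M * w * (q * (1 - z) ^+ 2 - z * (1 + y))); first by ring.
by rewrite qz subrr mulr0.
Qed.

Lemma sum_qterm N :
  \sum_(m < N.+1) qterm N m = \prod_(i < N) ((1 + x ^+ i.+1) / (1 - x ^+ i.+1)).
Proof.
elim: N => [|N IH]; first by rewrite big_ord1 big_ord0 /qterm !big_ord0 mulr1.
rewrite [RHS]big_ord_recr /= -IH mulrA; apply: (canRL (mulrK (unit1 N))).
have := qterm_telescope (leqnn N).
rewrite sumrB -!mulr_sumr => /eqP; rewrite subr_eq => /eqP e.
(* The term m = N + 1 lies outside the telescoped range; multiplied by 1 - x^(N+1), it cancels the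
   boundary term by the relation for [qcoef N]. *)
rewrite big_ord_recr /= mulrDl [X in X + _]mulrC e qtermSS.
have : qcoef N * (1 - x ^+ N.+1) ^+ 2 = x ^+ N.+1 * (1 + x ^+ N).
  by rewrite divrK // unitrX.
set z := x ^+ N.+1; set q := qcoef N; set t := qterm N N => qz.
transitivity ((1 + z) * \sum_(i < N.+1) qterm N i
  + t * (q * (1 - z) ^+ 2 - z * (1 + x ^+ N))); first by ring.
rewrite qz; ring.
Qed.

Lemma sum_prod_qcoef n : x ^+ n.+1 = 0 ->
  \sum_(m < n.+1) \prod_(i < m) qcoef i =
  \prod_(i < n) ((1 + x ^+ i.+1) / (1 - x ^+ i.+1)).
Proof.
move=> x0; rewrite -sum_qterm; apply: eq_bigr => -[m mn] _ /=.
symmetry; apply: mulr_prod_id => i.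
have -> : \prod_(j < m) qcoef j = x ^+ m * \prod_(j < m)
    (x ^+ j * (1 + x ^+ j) / (1 - x ^+ j.+1) ^+ 2).
  rewrite -[in x ^+ m](card_ord m) -prodr_const -big_split /=.
  by apply: eq_bigr => j _; rewrite /qcoef exprS !mulrA.
(* x^m x^(n-i) = 0 for i < m: truncating at N = n loses nothing. *)
rewrite mulrBr mulr1 mulrAC -exprD.
rewrite (@expr_nilp_ge _ _ _ (m + (n - i)) x0) ?mul0r ?subr0 //.
by have := ltn_ord i; lia.
Qed.

End QSeries.

(** * Truncated sums over one gap or one multiplicity *)

Section GeometricSums.
Variables (R : comUnitRingType) (y : R).

(** Accounts for a gap d + 1 between consecutive parts, of weight 2(d + 1) - 1. *)
Lemma sum_odd_geom n : y ^+ n.+1 = 0 ->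
  (1 - y) ^+ 2 * (\sum_(0 <= d < n) (2 * d%:R + 1) * y ^+ d.+1) = y * (1 + y).
Proof.
move=> y0.
(* The remainder after n terms is kept exactly, so that induction applies; nilpotence removes it
   afterwards. *)
have -> : (1 - y) ^+ 2 * (\sum_(0 <= d < n) (2 * d%:R + 1) * y ^+ d.+1) =
   y * (1 + y) - y ^+ n.+1 * (2 * n%:R + 1 - (2 * n%:R - 1) * y).
  elim: (n) => [|N IH]; first by rewrite big_geq //; ring.
  rewrite big_nat_recr //= mulrDr IH -(natr1 N) [y ^+ N.+2]exprS.
  by move: (y ^+ N.+1) (N%:R : R) => z a; ring.
by rewrite y0; ring.
Qed.

(** Accounts for the smallest part d + 1, whose factor is 2(d + 1). *)
Lemma sum_even_geom n : y ^+ n.+1 = 0 ->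
  (1 - y) ^+ 2 * (\sum_(0 <= d < n) 2 * d.+1%:R * y ^+ d.+1) = 2 * y.
Proof.
move=> y0.
have -> : (1 - y) ^+ 2 * (\sum_(0 <= d < n) 2 * d.+1%:R * y ^+ d.+1) =
   2 * y - y ^+ n.+1 * (2 * (n%:R + 1) - 2 * n%:R * y).
  elim: (n) => [|N IH]; first by rewrite big_geq //; ring.
  rewrite big_nat_recr //= mulrDr IH -(natr1 N) [y ^+ N.+2]exprS.
  by move: (y ^+ N.+1) (N%:R : R) => z a; ring.
by rewrite y0; ring.
Qed.

(** Accounts for the multiplicity of one part size: weight 1 if absent, 2 otherwise. *)
Lemma sum_geom2 n : y ^+ n.+1 = 0 ->
  (1 - y) * (1 + \sum_(0 <= d < n) 2 * y ^+ d.+1) = 1 + y.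
Proof.
move=> y0.
have -> : (1 - y) * (1 + \sum_(0 <= d < n) 2 * y ^+ d.+1) =
   1 + y - 2 * y ^+ n.+1.
  elim: (n) => [|N IH]; first by rewrite big_geq //; ring.
  rewrite big_nat_recr //= addrA mulrDr IH [y ^+ N.+2]exprS.
  by move: (y ^+ N.+1) => z; ring.
by rewrite y0; ring.
Qed.
End GeometricSums.

(** * Enumeration of partitions into distinct parts *)

Definition is_distinct_partition (p : seq nat) : bool :=
  is_partition p && uniq p.

(** For empty [p] the default 0 of [head] turns the inequality into positivity of [a]. *)
Lemma is_distinct_partition_cons a p :
  is_distinct_partition (a :: p) =
  (head 0%N p < a)%N && is_distinct_partition p.
Proof.
have E q : is_distinct_partition q = sorted gtn q && (0%N \notin q).
  rewrite gtn_sorted_uniq_geq /is_distinct_partition /is_partition.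
  by rewrite andbC andbA.
rewrite !E; case: p => [|b p] /=; first by rewrite !inE eq_sym -lt0n andbT.
rewrite inE negb_or eq_sym -lt0n -!andbA; case: ltnP => //= ba.
by rewrite (leq_trans _ ba).
Qed.

(* Partitions into m distinct parts with lambda_i - lambda_(i+1) <= n for
   all i <= m, where lambda_(m+1) = 0. *)
Fixpoint distinct_lists (n m : nat) : seq (seq nat) :=
  if m is m'.+1 then
    [seq (d.+1 + head 0 p)%N :: p
      | d <- index_iota 0 n, p <- distinct_lists n m']
  else [:: [::]].

Lemma size_distinct_lists n m p : p \in distinct_lists n m -> size p = m.
Proof.
elim: m p => [|m IH] p /=; first by rewrite inE => /eqP->.
by case/allpairsP => -[d q] /= [_ /IH <- ->].
Qed.

Lemma distinct_listsP n m p :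
  p \in distinct_lists n m -> is_distinct_partition p.
Proof.
elim: m p => [|m IH] p /=; first by rewrite inE => /eqP->.
case/allpairsP => -[d q] /= [_ /IH dq ->].
by rewrite is_distinct_partition_cons dq addSn ltnS leq_addl.
Qed.

Lemma mem_distinct_lists n p :
  is_distinct_partition p -> (head 0 p <= n)%N ->
  p \in distinct_lists n (size p).
Proof.
elim: p => // a p IH; rewrite is_distinct_partition_cons /= => /andP[pa dp] an.
apply/allpairsP; exists ((a - head 0 p).-1%N, p); split => /=.
- by rewrite mem_index_iota /=; lia.
- by apply: IH => //; lia.
- by congr (_ :: _); lia.
Qed.

Lemma uniq_distinct_lists n m : uniq (distinct_lists n m).
Proof.
elim: m => //= m IH; apply: allpairs_uniq => //; first exact: iota_uniq.
by move=> [d p] [d' p'] _ _ /= [/[swap] -> /addIn ->].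
Qed.

(** The conventional next part -1/2 contributes +1, which cancels the -1 of the factor. *)
Lemma omega1_tilde1 a : omega1_tilde [:: a] = 2 * a%:R.
Proof. by rewrite /omega1_tilde big_nat1 /part /=; field. Qed.

Lemma omega1_tilde_cons a b p :
  omega1_tilde (a :: b :: p) =
  (2 * a%:R - 2 * b%:R - 1) * omega1_tilde (b :: p).
Proof.
rewrite /omega1_tilde [LHS]big_nat_recl //=; congr (_ * _).
by apply: eq_big_nat => -[|i].
Qed.

(** * Enumeration of all partitions by multiplicities *)

(* Partitions with parts at most m and multiplicities at most n. *)
Fixpoint partition_lists (n m : nat) : seq (seq nat) :=
  if m is m'.+1 then
    [seq nseq c m ++ p | c <- index_iota 0 n.+1, p <- partition_lists n m']
  else [:: [::]].

Lemma partition_listsS n m : partition_lists n m.+1 =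
  [seq nseq c m.+1 ++ p | c <- index_iota 0 n.+1, p <- partition_lists n m].
Proof. by []. Qed.

Lemma partition_lists_le n m p : p \in partition_lists n m -> all (geq m) p.
Proof.
elim: m p => [|m IH] p; first by rewrite inE => /eqP->.
rewrite partition_listsS; case/allpairsP => -[c q] /= [_ /IH qm ->].
rewrite all_cat all_nseq /= leqnn orbT.
by apply: sub_all qm => i /= /leqW.
Qed.

Lemma geq_trans : transitive geq.
Proof. exact/rev_trans/leq_trans. Qed.

Lemma partition_listsP n m p : p \in partition_lists n m -> is_partition p.
Proof.
elim: m p => [|m IH] p; first by rewrite inE => /eqP->.
rewrite partition_listsS; case/allpairsP => -[c q] /= [_ qm ->].
move: (partition_lists_le qm) (IH _ qm).
rewrite /is_partition mem_cat mem_nseq andbF /= => le_q /andP[sq ->].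
rewrite andbT.
elim: c => //= c IHc; rewrite path_sortedE; last exact: geq_trans.
rewrite IHc andbT all_cat all_nseq /= leqnn orbT.
by apply: sub_all le_q => i /= /leqW.
Qed.

(** Inverts the recursive step of [partition_lists]: the copies of the largest allowed part come
    first. *)
Lemma partition_split m p : sorted geq p -> all (geq m) p ->
  p = nseq (count_mem m p) m ++ [seq i <- p | i != m].
Proof.
elim: p => //= a p IH; rewrite path_sortedE; last exact: geq_trans.
move=> /andP[ap sp] /andP[am pm]; case: (eqVneq a m) => [->|nam] /=.
  by rewrite {1}(IH sp pm).
have lt_m i : i \in p -> i != m.
  by move=> /(allP ap) /= ia; apply: contraNneq nam => im; lia.
have -> : count_mem m p = 0%N.
  by apply/count_memPn; apply/negP => /lt_m; rewrite eqxx.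
by congr (_ :: _); apply/esym/all_filterP/allP.
Qed.

Lemma mem_partition_lists n m p : is_partition p -> all (geq m) p ->
  (sumn p <= n)%N -> p \in partition_lists n m.
Proof.
elim: m p => [|m IH] p.
  case: p => //= a p /andP[_]; rewrite inE negb_or => /andP[a0 _] /andP[].
  by rewrite leqn0 eq_sym (negPf a0).
move=> /andP[sp p0] pm pn; have e := partition_split sp pm.
rewrite partition_listsS; apply/allpairsP.
exists (count_mem m.+1 p, [seq i <- p | i != m.+1]); split => //=.
- rewrite mem_index_iota /= ltnS; apply: leq_trans pn.
  by rewrite [in leqRHS]e sumn_cat sumn_nseq mulSn -addnA leq_addr.
- apply: IH.
  + rewrite /is_partition sorted_filter //; last exact: geq_trans.
    by rewrite mem_filter negb_and p0 orbT.
  + apply/allP => i; rewrite mem_filter => /andP[im /(allP pm)] /=.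
    by rewrite leq_eqVlt (negPf im).
  + by apply: leq_trans pn; rewrite [in leqRHS]e sumn_cat leq_addl.
Qed.

Lemma notin_partition_lists n m p : p \in partition_lists n m -> m.+1 \notin p.
Proof.
by move=> /partition_lists_le pm; apply/negP => /(allP pm) /=; rewrite ltnn.
Qed.

Lemma uniq_partition_lists n m : uniq (partition_lists n m).
Proof.
elim: m => // m IH; rewrite partition_listsS.
have : uniq (index_iota 0 n.+1) by exact: iota_uniq.
move: (index_iota 0 n.+1) => s us; apply: allpairs_uniq => //.
move=> [c p] [c' p'] /allpairsP[[c1 p1] /= [_ hp [? ?]]]
  /allpairsP[[c2 p2] /= [_ hp' [? ?]]].
(* The tails have parts at most m, so counting m + 1 recovers the multiplicity. *)
subst => e; have := congr1 (count_mem m.+1) e.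
rewrite !count_cat !count_nseq /= eqxx !mul1n.
rewrite !(count_memPn _) ?(notin_partition_lists hp)
  ?(notin_partition_lists hp') // !addn0 => cc.
by move: e; rewrite cc => /eqP; rewrite eqseq_cat // eqxx => /eqP ->.
Qed.

Lemma omega1_prime_nseq c m p : m \notin p ->
  omega1_prime (nseq c m ++ p) = (if c is 0 then 1 else 2) * omega1_prime p.
Proof.
move=> mp; rewrite /omega1_prime /num_distinct_parts undup_cat size_cat exprD.
congr (_ * _); case: c => // c.
have -> : undup (nseq c.+1 m) = [:: m].
  by elim: c => //= c ->; rewrite inE eqxx.
by rewrite /= mp.
Qed.

(** * Generating functions of the two families *)

Section GeneratingFunctions.
Variables (R : comUnitAlgType rat) (x : R) (n : nat).
Hypothesis x0 : x ^+ n.+1 = 0.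

Let y0 i : (x ^+ i.+1) ^+ n.+1 = 0.
Proof. by rewrite -exprM (expr_nilp_ge x0) // leq_pmull. Qed.

Let unit1 i : 1 - x ^+ i.+1 \is a GRing.unit.
Proof. exact: unit_sub_nilp i x0. Qed.

Lemma scale_even (d : nat) (v : R) : (2 * d%:R : rat) *: v = 2 * d%:R * v.
Proof. by rewrite -scalerA !scaler_nat -mulrA !mulr_natl. Qed.

Lemma scale_odd (d : nat) (v : R) :
  (2 * d%:R + 1 : rat) *: v = (2 * d%:R + 1) * v.
Proof. by rewrite scalerDl scale1r scale_even [RHS]mulrDl mul1r. Qed.

(* The extra variable z = x^k marking the largest part makes the recursion on m
   close up: adding a new largest part replaces k by k + 1. *)
Lemma sum_distinct_lists k m :
  \sum_(p <- distinct_lists n m.+1)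
     omega1_tilde p *: x ^+ (k * head 0 p + sumn p) =
  (\prod_(i < m) (x ^+ (i + k).+1 * (1 + x ^+ (i + k).+1)
                  / (1 - x ^+ (i + k).+1) ^+ 2)) *
  (2 * x ^+ (m + k).+1 / (1 - x ^+ (m + k).+1) ^+ 2).
Proof.
elim: m k => [|m IH] k.
  rewrite big_ord0 mul1r add0n -(sum_even_geom (y0 k)) mulrC mulKr ?unitrX //.
  rewrite big_allpairs_dep; apply: eq_bigr => d _.
  rewrite big_seq1 omega1_tilde1 /= !addn0 -exprM scale_even.
  by congr (_ * x ^+ _); lia.
(* The factor i = 0 sums over the top gap; the others, reindexed, form the product for k + 1. *)
rewrite big_ord_recl -mulrA.
under [X in _ = _ * (X * _)]eq_bigr do rewrite lift0 addSnnS.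
rewrite addSnnS -IH -(sum_odd_geom (y0 k)) [X in X / _]mulrC mulrK ?unitrX //.
rewrite big_allpairs_dep mulr_suml; apply: eq_bigr => d _.
(* The tail has m + 1 parts, so its head [b] is a genuine part and not the convention -1/2. *)
rewrite mulr_sumr big_seq [RHS]big_seq; apply: eq_bigr => -[|b p].
  by move=> h; have := @size_distinct_lists n m.+1 [::] h.
move=> _; rewrite omega1_tilde_cons /=.
have -> : 2 * (d.+1 + b)%:R - 2 * b%:R - 1 = 2 * d%:R + 1 :> rat.
  by rewrite natrD -natr1; ring.
rewrite -scalerA scale_odd -mulrA; congr (_ * _).
rewrite -scalerAr -exprM -exprD; congr (_ *: x ^+ _); lia.
Qed.

Lemma sum_distinct_lists_qcoef m :
  \sum_(p <- distinct_lists n m) omega1_tilde p *: x ^+ sumn p =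
  \prod_(i < m) qcoef x i.
Proof.
case: m => [|m].
  by rewrite big_seq1 big_ord0 /omega1_tilde big_geq //= scale1r.
have := sum_distinct_lists 0 m; under eq_bigr do rewrite mul0n add0n.
move=> ->; under eq_bigr do rewrite addn0; rewrite addn0.
(* The 2 from the smallest part is 1 + x^0, the factor missing from the shifted product. *)
transitivity ((\prod_(i < m.+1) (x ^+ i.+1 / (1 - x ^+ i.+1) ^+ 2)) *
  \prod_(i < m.+1) (1 + x ^+ i)).
  rewrite big_ord_recr [X in _ = _ * X]big_ord_recl /= expr0.
  under eq_bigr do rewrite mulrAC.
  rewrite big_split /=.
  under [X in _ = _ * (_ * X)]eq_bigr do rewrite /bump leq0n add1n.
  ring.
by rewrite -big_split; apply: eq_bigr => i _; rewrite /qcoef mulrAC.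
Qed.

Lemma sum_partition_lists m :
  \sum_(p <- partition_lists n m) omega1_prime p *: x ^+ sumn p =
  \prod_(i < m) ((1 + x ^+ i.+1) / (1 - x ^+ i.+1)).
Proof.
elim: m => [|m IH].
  by rewrite big_seq1 big_ord0 /omega1_prime scale1r.
rewrite [RHS]big_ord_recr [RHS]/= -IH -(sum_geom2 (y0 m)) mulrC.
rewrite [X in X / _]mulrC mulrK // partition_listsS big_allpairs_dep.
rewrite big_nat_recl // mulrDl mul1r.
have E c : \sum_(p <- partition_lists n m)
    omega1_prime (nseq c m.+1 ++ p) *: x ^+ sumn (nseq c m.+1 ++ p) =
  (if c is 0 then 1 else 2) * (x ^+ m.+1) ^+ c *
  \sum_(p <- partition_lists n m) omega1_prime p *: x ^+ sumn p.
  rewrite mulr_sumr big_seq [RHS]big_seq; apply: eq_bigr => p pm.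
  rewrite omega1_prime_nseq ?(notin_partition_lists pm) //.
  rewrite sumn_cat sumn_nseq exprD exprM -scalerA -mulrA -[in RHS]scalerAr.
  by case: c => [|c]; rewrite ?scale1r ?mul1r // scaler_nat mulr_natl.
rewrite E mulr1 mul1r; congr (_ + _).
by rewrite mulr_suml; apply: eq_bigr => c _; rewrite E.
Qed.

Lemma sum_distinct_eq_partition :
  \sum_(p <- [seq p | m <- index_iota 0 n.+1, p <- distinct_lists n m])
     omega1_tilde p *: x ^+ sumn p =
  \sum_(p <- partition_lists n n) omega1_prime p *: x ^+ sumn p.
Proof.
rewrite sum_partition_lists -sum_prod_qcoef // big_allpairs_dep big_mkord.
by apply: eq_bigr => m _; rewrite sum_distinct_lists_qcoef.
Qed.
End GeneratingFunctions.

(** * Passage back to coefficients of power series *)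

Lemma coef_in_qpoly_Xn (F : fieldType) (n i : nat) (p q : {poly F}) :
  (i < n.+1)%N -> in_qpoly ('X^(n.+1)) p = in_qpoly ('X^(n.+1)) q ->
  p`_i = q`_i.
Proof.
move=> lt_in /(congr1 (fun u : {poly %/ ('X^(n.+1) : {poly F})} => val u)) /=.
rewrite mk_monic_Xn /= => pq.
(* Each polynomial is the common remainder plus a multiple of X^(n+1), invisible in degree i. *)
rewrite (Pdiv.RingMonic.rdivp_eq (monicXn F n.+1) p).
rewrite (Pdiv.RingMonic.rdivp_eq (monicXn F n.+1) q).
by rewrite pq !coefD !coefMXn lt_in.
Qed.

(** The list [r] may hold partitions of other sizes: they do not affect the coefficient at n. *)
Lemma fps_sum_coef (A : set (seq nat)) (w : seq nat -> rat) n
    (r : seq (seq nat)) :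
  uniq r -> (forall p, p \in r -> A p) ->
  (forall p, A p -> sumn p = n -> p \in r) ->
  fps_sum A (fun p => fps_monomial (w p) (sumn p)) n =
  (\sum_(p <- r) w p *: 'X^(sumn p))`_n.
Proof.
move=> ur rA Ar; rewrite /fps_sum (fsbigE r) //; last first.
  move=> p Ap; apply: contraNeq; rewrite /fps_monomial.
  by case: (n =P sumn p) => [e _|_]; [exact: Ar | rewrite eqxx].
rewrite big_seq_cond coef_sum [RHS]big_seq; apply: eq_big => [p|p _].
  by case: (boolP (p \in r)) => //= /rA Ap; exact: mem_set.
by rewrite coefZ coefXn /fps_monomial; case: eqP; rewrite ?mulr1 ?mulr0.
Qed.

Lemma sumn_head_le p : (head 0 p <= sumn p)%N.
Proof. by case: p => //= a p; rewrite leq_addr. Qed.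

Lemma mem_le_sumn p i : i \in p -> (i <= sumn p)%N.
Proof.
elim: p => //= a p IH; rewrite inE => /orP[/eqP->|/IH h]; first exact: leq_addr.
exact: leq_trans h (leq_addl _ _).
Qed.

Lemma size_le_sumn p : 0%N \notin p -> (size p <= sumn p)%N.
Proof.
elim: p => //= a p IH; rewrite inE negb_or eq_sym -lt0n => /andP[a0 /IH h].
by rewrite -add1n leq_add.
Qed.

Theorem theorem4p2 :
  fps_sum distinct_partitions
    (fun p : seq nat => fps_monomial (omega1_tilde p) (sumn p)) =
  fps_sum all_partitions
    (fun p : seq nat => fps_monomial (omega1_prime p) (sumn p)).
Proof.
apply: funext => n.
rewrite (@fps_sum_coef _ _ n
  [seq p | m <- index_iota 0 n.+1, p <- distinct_lists n m]).
- rewrite (@fps_sum_coef _ _ n (partition_lists n n)).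
  + apply: (@coef_in_qpoly_Xn _ n) => //.
    (* The class of X is the nilpotent x of the generating functions. *)
    have X0 : (in_qpoly ('X^(n.+1)) 'X : {poly %/ ('X^(n.+1) : {poly rat})})
        ^+ n.+1 = 0.
      rewrite -rmorphXn; apply: val_inj => /=.
      by rewrite mk_monic_Xn Pdiv.RingMonic.rmodpp ?monicXn.
    rewrite !rmorph_sum; have := sum_distinct_eq_partition X0.
    under eq_bigr do rewrite -rmorphXn -in_qpolyZ.
    by under [X in _ = X -> _]eq_bigr do rewrite -rmorphXn -in_qpolyZ.
  + exact: uniq_partition_lists.
  + by move=> p /partition_listsP.
  + move=> p pp pn; apply: mem_partition_lists => //; last by rewrite pn.
    by apply/allP => i /mem_le_sumn; rewrite pn.
- apply: allpairs_uniq_dep => [|m _|];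
    [exact: iota_uniq|exact: uniq_distinct_lists|].
  (* The index m is recovered as the number of parts. *)
  move=> [m p] [m' p'] /allpairsPdep[m1 [p1 [_ h ->]]]
    /allpairsPdep[m2 [p2 [_ h' ->]]] /= e.
  by move: h h'; rewrite e => /size_distinct_lists <- /size_distinct_lists <-.
- by move=> p /allpairsPdep[m [q [_ /distinct_listsP h ->]]].
- move=> p dp pn; apply/allpairsPdep; exists (size p), p; split => //.
    rewrite mem_index_iota /= ltnS -pn size_le_sumn //.
    by case/andP: dp => /andP[].
  by apply: mem_distinct_lists; rewrite // -[leqRHS]pn sumn_head_le.
Qed.
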